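(* Let $V$ and $W$ be finite-dimensional complex vector spaces. (i) Let $P: W\otimes V\to V\otimes W$ be a regular $K$-projector. Then there is a $P$-algebra structure $(\mu,\lambda)$ on $V$ such that the operators $\rho_P(u\otimes x)$, $u\in V$, $x\in V^*$, defined by $$\rho_P(u\otimes x)\,w=(x\otimes \mathrm{id}_W)\,P(w\otimes u),\qquad w\in W,$$ satisfy the defining relations of the weak envelope $En_w(V)$ of the $P$-algebra $(V,\mu,\lambda)$; that is, $\rho_P$ defines a representation of $En_w(V)$ in $W$. (ii) Given a $P$-algebra structure on $V$ and a representation of $En_w(V)$ in $W$ obtained as in (i) from a regular $K$-projector $P$, the $K$-projector $P$ can be reconstructed from them, by the formula $P(w\otimes u)=\sum_j e_j\otimes (u\otimes e^j)\cdot w$, where $e_1,\dots,e_n$ is a basis of $V$ and $e^1,\dots,e^n$ is the dual basis of $V^*$. (iii) Conversely, given an arbitrary $P$-algebra structure on $V$ and an arbitrary representation of $En_w(V)$ in $W$, the linear map $P: W\otimes V\to V\otimes W$, $P(w\otimes u)=\sum_j e_j\otimes (u\otimes e^j)\cdot w$, makes $V$ a representation of $T^*(W\otimes W^* )$ (an object of $\mathbb{A}_W$) such that $V\otimes V\cong V\oplus V_0$ in $\mathbb{A}_W$ for some object $V_0$. However, in general it need not be the case that $[V_0]=0$, and $V$ need not be irreducible as a representation of $T^*(W\otimes W^* )$.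
   Context: All vector spaces are finite-dimensional over $\mathbb{C}$ (except free algebras and their quotients). Associative algebras, coalgebras, their homomorphisms and their representations are not required to be unital/counital. **The category $\mathbb{A}_W$.** For a vector space $W$, $T^*(W\otimes W^* )$ is the free associative algebra generated by $W\otimes W^*$, and $\mathbb{A}_W$ is the category of its finite-dimensional representations. An object $V$ is the same thing as an arbitrary linear map $W\otimes W^*\otimes V\to V$, equivalently an arbitrary linear map $P:W\otimes V\to V\otimes W$ (where $w\otimes\xi\in W\otimes W^*$ acts on $V$ by $v\mapsto(\mathrm{id}_V\otimes\xi)P(w\otimes v)$). The tensor product of $P_1:W\otimes V_1\to V_1\otimes W$ and $P_2:W\otimes V_2\to V_2\otimes W$ is $V_1\otimes V_2$ with the map $$W\otimes V_1\otimes V_2\xrightarrow{P_1\otimes 1}V_1\otimes W\otimes V_2\xrightarrow{1\otimes P_2}V_1\otimes V_2\otimes W.$$ A zero representation is one in which all elements of $W\otimes W^*$ act by zero. $[V]$ denotes the class of $V$ in the Grothendieck group of $\mathbb{A}_W$, with the convention that classes of zero representations are $0$ (i.e. the Grothendieck group is taken modulo the classes of zero representations). **$K$-projectors.** A $K$-projector is a linear map $P:W\otimes V\to V\otimes W$ such that $[V\otimes V]=[V]$, where $V$ is regarded as an object of $\mathbb{A}_W$ via $P$. It is called *regular* if $V$ is an irreducible representation of $T^*(W\otimes W^* )$ and $V\otimes V\cong V\oplus V_0$ with $[V_0]=0$. **$P$-algebras.** A $P$-algebra is a vector space $V$ with linear maps $\mu:V\otimes V\to V$ and $\lambda:V\to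 V\otimes V$ such that $\mu$ is an associative multiplication, $\lambda$ is a coassociative comultiplication, and $\mu\circ\lambda=\mathrm{id}_V$. (No compatibility making $V$ a bialgebra is required.) **Weak envelope.** Let $\mu^*:V^*\to V^*\otimes V^*$ and $\lambda^*:V^*\otimes V^*\to V^*$ be the dual maps. The weak envelope $En_w(V)$ of a $P$-algebra $V$ is the associative algebra generated by $V\otimes V^*$ with defining relations, for all $u,v\in V$, $x,y\in V^*$, $$\sum_\alpha (u\otimes x''_\alpha)(v\otimes x'_\alpha)=\mu(v\otimes u)\otimes x,\quad\text{where }\mu^*(x)=\sum_\alpha x'_\alpha\otimes x''_\alpha,$$ $$\sum_\alpha (u''_\alpha\otimes x)(u'_\alpha\otimes y)=u\otimes\lambda^*(y\otimes x),\quad\text{where }\lambda(u)=\sum_\alpha u'_\alpha\otimes u''_\alpha .$$ *)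

(* Defs.v *)
From HB Require Import structures.
From mathcomp Require Import all_boot all_order all_algebra.
From mathcomp Require Import reals complex.

Set Implicit Arguments.
Unset Strict Implicit.
Unset Printing Implicit Defensive.

Import GRing.Theory.
Local Open Scope ring_scope.

Reserved Notation "V \ox W" (at level 40, left associativity).
Reserved Notation "v \oxv w" (at level 40, left associativity).
Reserved Notation "f \oxf g" (at level 40, left associativity).

Lemma linfunE (K : fieldType) (V W : vectType K) (f : V -> W) :
  linear f -> linfun f =1 f.
Proof.
move=> linf.
pose h : {linear V -> W} :=
  HB.pack f (GRing.isLinear.Build K V W *:%R f linf).
exact: (lfunE h).
Qed.

Lemma linear_fsum0 (K : fieldType) (V W : vectType K) (f : V -> W) n
    (v : 'I_n -> V) :
  linear f -> f (\sum_i v i) = \sum_i f (v i).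
Proof.
move=> linf; rewrite -(linfunE linf) linear_sum.
by apply: eq_bigr => i _; exact: linfunE.
Qed.

Lemma linear_fscale (K : fieldType) (V W : vectType K) (f : V -> W) a v :
  linear f -> f (a *: v) = a *: f v.
Proof. by move=> linf; rewrite -!(linfunE linf) linearZ. Qed.

Lemma linear_fsum (K : fieldType) (V W : vectType K) (f : V -> W) n
    (a : 'I_n -> K) (v : 'I_n -> V) :
  linear f -> f (\sum_i a i *: v i) = \sum_i a i *: f (v i).
Proof.
move=> linf; rewrite linear_fsum0 //.
by apply: eq_bigr => i _; rewrite linear_fscale.
Qed.

Section Tensor.
Variable K : fieldType.
Implicit Types U V W : vectType K.

Definition dual V : vectType K := 'Hom(V, K^o).

(* The tensor product is realised as Hom(V^*, W), the pure tensor of v and w  *)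
(* being the map x |-> x(v) w. Everything below only uses pure tensors and    *)
(* the universal property (tens_liftE and tens_ext).                          *)
Definition tens V W : vectType K := 'Hom(dual V, W).
Notation "V \ox W" := (tens V W) : type_scope.

Definition pure V W (v : V) (w : W) : V \ox W :=
  linfun (fun x : dual V => (x v : K) *: w).
Notation "v \oxv w" := (pure v w) : ring_scope.

Definition dual_coord V n (e : n.-tuple V) (j : 'I_n) : dual V :=
  linfun (coord e j : V -> K^o).

Definition bilin U V W (b : V -> W -> U) : Prop :=
  (forall v, linear (b v)) /\ (forall w, linear (b^~ w)).

(* For b not bilinear this is a junk value; it is only used for bilinear b.   *)
Definition tens_lift U V W (b : V -> W -> U) : 'Hom((V \ox W)%type, U) :=
  linfun (fun t : V \ox W =>
    \sum_(i < \dim {:V})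
      b (vbasis {:V})`_i (t (dual_coord (vbasis {:V}) i))).

Lemma pureE V W (v : V) (w : W) (x : dual V) : (v \oxv w) x = (x v : K) *: w.
Proof.
rewrite linfunE // => a y z /=.
by rewrite add_lfunE scale_lfunE scalerDl scalerA.
Qed.

Lemma dual_coordE V n (e : n.-tuple V) j v : dual_coord e j v = coord e j v.
Proof. by rewrite linfunE // => a y z; rewrite linearP. Qed.

Lemma pure_bilin V W : bilin (@pure V W).
Proof.
split=> [v|w] a y z; apply/lfunP=> x;
  rewrite add_lfunE scale_lfunE !pureE.
  by rewrite scalerDr !scalerA mulrC.
by rewrite linearP scalerDl scalerA.
Qed.

Lemma vbasis_sum V (v : V) :
  v = \sum_(i < \dim {:V}) coord (vbasis {:V}) i v *: (vbasis {:V})`_i.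
Proof. by rewrite -coord_vbasis ?memvf. Qed.

Lemma dual_sum V (x : dual V) :
  x = \sum_(i < \dim {:V})
        (x (vbasis {:V})`_i : K) *: dual_coord (vbasis {:V}) i.
Proof.
apply/lfunP=> v; rewrite {1}(vbasis_sum v) linear_sum sum_lfunE.
apply: eq_bigr => i _.
by rewrite linearZ scale_lfunE dual_coordE /= /GRing.scale /= mulrC.
Qed.

Lemma tens_sum V W (t : V \ox W) :
  t = \sum_(i < \dim {:V})
        (vbasis {:V})`_i \oxv t (dual_coord (vbasis {:V}) i).
Proof.
apply/lfunP=> x; rewrite sum_lfunE.
rewrite {1}(dual_sum x).
by rewrite linear_sum; apply: eq_bigr => i _; rewrite linearZ pureE.
Qed.

Lemma tens_liftE U V W (b : V -> W -> U) v w :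
  bilin b -> tens_lift b (v \oxv w) = b v w.
Proof.
move=> [b2 b1].
rewrite linfunE => [|a s t]; last first.
  rewrite scaler_sumr -big_split /=; apply: eq_bigr => i _.
  by rewrite add_lfunE scale_lfunE b2.
rewrite [in RHS](vbasis_sum v) (linear_fsum _ _ (b1 w)).
apply: eq_bigr => i _; rewrite pureE dual_coordE.
exact: linear_fscale (b2 _).
Qed.

Lemma tens_ext U V W (f g : 'Hom((V \ox W)%type, U)) :
  (forall v w, f (v \oxv w) = g (v \oxv w)) -> f = g.
Proof.
move=> fg; apply/lfunP=> t; rewrite (tens_sum t) !linear_sum.
by apply: eq_bigr => i _; exact: fg.
Qed.

Definition tens_map V V' W W' (f : 'Hom(V, V')) (g : 'Hom(W, W')) :
  'Hom((V \ox W)%type, (V' \ox W')%type) :=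
  tens_lift (fun v w => f v \oxv g w).
Notation "f \oxf g" := (tens_map f g) : lfun_scope.

Definition assoc_r U V W :
  'Hom((U \ox V \ox W)%type, (U \ox (V \ox W))%type) :=
  tens_lift (fun (t : U \ox V) (w : W) =>
    tens_lift (fun (u : U) (v : V) => u \oxv (v \oxv w)) t).

Definition assoc_l U V W :
  'Hom((U \ox (V \ox W))%type, (U \ox V \ox W)%type) :=
  tens_lift (fun (u : U) (t : V \ox W) =>
    tens_lift (fun (v : V) (w : W) => (u \oxv v) \oxv w) t).

(* x (x) id_W and id_V (x) xi, with values in W resp. V. *)
Definition contr_l V W (x : dual V) : 'Hom((V \ox W)%type, W) :=
  tens_lift (fun v w => (x v : K) *: w).

Definition contr_r V W (xi : dual W) : 'Hom((V \ox W)%type, V) :=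
  tens_lift (fun v w => (xi w : K) *: v).

(* V^* (x) W^* -> (V (x) W)^*, (x (x) y)(v (x) w) = x(v) y(w). *)
Definition dual_tens V W : 'Hom((dual V \ox dual W)%type, dual (V \ox W)) :=
  tens_lift (fun (x : dual V) (y : dual W) =>
    tens_lift (fun (v : V) (w : W) => (x v * y w : K^o))).

Lemma pureDl V W (w : W) : linear (fun v : V => v \oxv w).
Proof. exact: (pure_bilin V W).2. Qed.

Lemma pureDr V W (v : V) : linear (fun w : W => v \oxv w).
Proof. exact: (pure_bilin V W).1. Qed.

Lemma tens_mapE V V' W W' (f : 'Hom(V, V')) (g : 'Hom(W, W')) v w :
  (f \oxf g)%VF (v \oxv w) = f v \oxv g w.
Proof.
by rewrite tens_liftE //; split=> [y|y] a s t; rewrite linearP ?pureDl ?pureDr.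
Qed.

Lemma assoc_rE U V W (u : U) (v : V) (w : W) :
  assoc_r U V W (u \oxv v \oxv w) = u \oxv (v \oxv w).
Proof.
have b1 (z : W) : bilin (fun (u : U) (v : V) => u \oxv (v \oxv z)).
  by split=> [y|y] a s t; rewrite ?pureDl ?pureDr.
rewrite tens_liftE ?tens_liftE //; split=> [y|y] a s t; last exact: linearP.
rewrite -scale_lfunE -add_lfunE; congr (fun_of_lfun _ y).
apply: tens_ext => p q; rewrite add_lfunE scale_lfunE !tens_liftE //.
by rewrite !pureDr.
Qed.

Lemma assoc_lE U V W (u : U) (v : V) (w : W) :
  assoc_l U V W (u \oxv (v \oxv w)) = u \oxv v \oxv w.
Proof.
have b1 (z : U) : bilin (fun (v : V) (w : W) => z \oxv v \oxv w).
  by split=> [y|y] a s t; rewrite ?pureDr ?pureDl.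
rewrite tens_liftE ?tens_liftE //; split=> [y|y] a s t; first exact: linearP.
rewrite -scale_lfunE -add_lfunE; congr (fun_of_lfun _ y).
apply: tens_ext => p q; rewrite add_lfunE scale_lfunE !tens_liftE //.
by rewrite !pureDl.
Qed.

Lemma tens_ext_l U V W (X : vectType K) (f g : 'Hom((U \ox V \ox W)%type, X)) :
  (forall u v w, f (u \oxv v \oxv w) = g (u \oxv v \oxv w)) -> f = g.
Proof.
move=> fg; apply: tens_ext => t w.
have e (h : 'Hom((U \ox V \ox W)%type, X)) :
    linear (fun r : U \ox V => h (r \oxv w)).
  by move=> a y z; rewrite pureDl linearP.
rewrite -[LHS](linfunE (e f)) -[RHS](linfunE (e g)).
congr (fun_of_lfun _ t); apply: tens_ext => u v.
by rewrite (linfunE (e f)) (linfunE (e g)).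
Qed.

Lemma tens_ext_r U V W (X : vectType K) (f g : 'Hom((U \ox (V \ox W))%type, X)) :
  (forall u v w, f (u \oxv (v \oxv w)) = g (u \oxv (v \oxv w))) -> f = g.
Proof.
move=> fg; apply: tens_ext => u t.
have e (h : 'Hom((U \ox (V \ox W))%type, X)) :
    linear (fun r : V \ox W => h (u \oxv r)).
  by move=> a y z; rewrite pureDr linearP.
rewrite -[LHS](linfunE (e f)) -[RHS](linfunE (e g)).
congr (fun_of_lfun _ t); apply: tens_ext => v w.
by rewrite (linfunE (e f)) (linfunE (e g)).
Qed.

Lemma assoc_lK U V W : cancel (assoc_l U V W) (assoc_r U V W).
Proof.
move=> t; rewrite -comp_lfunE -[RHS]id_lfunE; congr (fun_of_lfun _ t).
by apply: tens_ext_r => u v w; rewrite comp_lfunE id_lfunE assoc_lE assoc_rE.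
Qed.

Lemma assoc_rK U V W : cancel (assoc_r U V W) (assoc_l U V W).
Proof.
move=> t; rewrite -comp_lfunE -[RHS]id_lfunE; congr (fun_of_lfun _ t).
by apply: tens_ext_l => u v w; rewrite comp_lfunE id_lfunE assoc_rE assoc_lE.
Qed.

Lemma contr_lE V W (x : dual V) (v : V) (w : W) :
  contr_l W x (v \oxv w) = (x v : K) *: w.
Proof.
rewrite tens_liftE //; split=> [y|y] a s t.
  by rewrite scalerDr !scalerA mulrC.
by rewrite linearP scalerDl scalerA.
Qed.

Lemma contr_rE V W (xi : dual W) (v : V) (w : W) :
  contr_r V xi (v \oxv w) = (xi w : K) *: v.
Proof.
rewrite tens_liftE //; split=> [y|y] a s t.
  by rewrite linearP scalerDl scalerA.
by rewrite scalerDr !scalerA mulrC.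
Qed.

Lemma dual_tensE V W (x : dual V) (y : dual W) v w :
  dual_tens V W (x \oxv y) (v \oxv w) = (x v : K) * (y w : K).
Proof.
have b1 (p : dual V) (q : dual W) :
    bilin (fun (v : V) (w : W) => (p v * q w : K^o)).
  split=> [z|z] a s t; rewrite linearP /GRing.scale /=.
    by rewrite mulrDr mulrCA.
  by rewrite mulrDl mulrA.
rewrite tens_liftE ?tens_liftE //; split=> [z|z] a s t;
  apply: tens_ext => p q; rewrite add_lfunE scale_lfunE !tens_liftE //;
  rewrite add_lfunE scale_lfunE /GRing.scale /=.
  by rewrite mulrDr mulrCA.
by rewrite mulrDl mulrA.
Qed.

Definition dual_split V W (f : dual (V \ox W)) : dual V \ox dual W :=
  \sum_(i < \dim {:V}) \sum_(j < \dim {:W})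
    (f ((vbasis {:V})`_i \oxv (vbasis {:W})`_j) : K) *:
    (dual_coord (vbasis {:V}) i \oxv dual_coord (vbasis {:W}) j).

Lemma dual_tensK V W : cancel (dual_tens V W) (@dual_split V W).
Proof.
have lin : linear (fun r => dual_split (dual_tens V W r)).
  move=> a y z; rewrite /dual_split.
  rewrite scaler_sumr -big_split; apply: eq_bigr => i _ /=.
  rewrite scaler_sumr -big_split; apply: eq_bigr => j _ /=.
  by rewrite linearP add_lfunE scale_lfunE scalerDl scalerA.
move=> r; rewrite -[LHS](linfunE lin) -[RHS]id_lfunE.
congr (fun_of_lfun _ r); apply: tens_ext => x y; rewrite id_lfunE linfunE //.
rewrite [in RHS](dual_sum x) (linear_fsum _ _ (pureDl y)).
apply: eq_bigr => i _.
rewrite [in RHS](dual_sum y) (linear_fsum _ _ (pureDr _)) scaler_sumr.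
by apply: eq_bigr => j _; rewrite scalerA dual_tensE.
Qed.

Lemma dual_splitK V W : cancel (@dual_split V W) (dual_tens V W).
Proof.
move=> f; apply: tens_ext => v w; rewrite linear_sum sum_lfunE.
rewrite [in RHS](vbasis_sum v) (linear_fsum _ _ (pureDl w)) linear_sum.
apply: eq_bigr => i _.
rewrite [in RHS](vbasis_sum w) (linear_fsum _ _ (pureDr _)).
rewrite scaler_sumr !linear_sum sum_lfunE; apply: eq_bigr => j _.
rewrite !linearZ scale_lfunE dual_tensE !dual_coordE /GRing.scale /=.
by rewrite mulrC -mulrA.
Qed.

Lemma dual_tens_invE V W (f : dual (V \ox W)) :
  dual_tens V W ((dual_tens V W)^-1%VF f) = f.
Proof.
rewrite limg_lfunVK //.
by rewrite -[f]dual_splitK memv_img ?memvf.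
Qed.

Definition inj_l U V : 'Hom(U, (U * V)%type) := linfun (fun u => (u, 0)).
Definition inj_r U V : 'Hom(V, (U * V)%type) := linfun (fun v => (0, v)).

Lemma inj_lE U V u : inj_l U V u = (u, 0).
Proof.
by rewrite linfunE // => a s t; congr pair; rewrite /= scaler0 addr0.
Qed.

Lemma inj_rE U V v : inj_r U V v = (0, v).
Proof.
by rewrite linfunE // => a s t; congr pair; rewrite /= scaler0 addr0.
Qed.

End Tensor.

Notation "V \ox W" := (tens V W) : type_scope.
Notation "v \oxv w" := (pure v w) : ring_scope.
Notation "f \oxf g" := (tens_map f g) : lfun_scope.

Section CategoryA.
Variables (K : fieldType) (W : vectType K).

Record objA := ObjA {
  carrier : vectType K;
  braid : 'Hom((W \ox carrier)%type, (carrier \ox W)%type)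
}.

Definition act (A : objA) (w : W) (xi : dual W) : 'End(carrier A) :=
  linfun (fun v => contr_r (carrier A) xi (braid A (w \oxv v))).

Lemma actE A w xi v :
  act A w xi v = contr_r (carrier A) xi (braid A (w \oxv v)).
Proof. by rewrite linfunE // => a s t; rewrite pureDr !linearP. Qed.

Definition homA (A B : objA) (f : 'Hom(carrier A, carrier B)) : Prop :=
  forall w xi v, f (act A w xi v) = act B w xi (f v).

Definition isoA (A B : objA) : Prop :=
  exists (f : 'Hom(carrier A, carrier B)) (g : 'Hom(carrier B, carrier A)),
    [/\ homA f, homA g, cancel f g & cancel g f].

Definition zero_rep (A : objA) : Prop := forall w xi, act A w xi = 0.

Definition irreducibleA (A : objA) : Prop :=
  ({:carrier A} != 0)%VS /\
  forall U : {vspace carrier A},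
    (forall w xi, (act A w xi @: U <= U)%VS) -> U = 0%VS \/ U = {:carrier A}%VS.

Definition tensA (A B : objA) : objA :=
  @ObjA (carrier A \ox carrier B)%type
    (assoc_l _ _ _ \o (\1 \oxf braid B) \o assoc_r _ _ _
       \o (braid A \oxf \1) \o assoc_l _ _ _)%VF.

Definition sumA (A B : objA) : objA :=
  @ObjA (carrier A * carrier B)%type
    (tens_lift (fun (w : W) (p : carrier A * carrier B) =>
       (inj_l _ _ \oxf \1)%VF (braid A (w \oxv p.1)) +
       (inj_r _ _ \oxf \1)%VF (braid B (w \oxv p.2)))).

Lemma act_sumA A B w xi v1 v2 :
  act (sumA A B) w xi (v1, v2) = (act A w xi v1, act B w xi v2).
Proof.
rewrite !actE tens_liftE; last first.
  split=> [y|y] a s t /=; rewrite ?pureDr ?pureDl !linearP /= scalerDr;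
  by rewrite addrACA.
have h1 t : contr_r (carrier (sumA A B)) xi ((inj_l _ _ \oxf \1)%VF t)
    = inj_l _ _ (contr_r _ xi t).
  rewrite -!comp_lfunE; congr (fun_of_lfun _ t); apply: tens_ext => p q.
  by rewrite !comp_lfunE tens_mapE !contr_rE !linearZ id_lfunE.
have h2 t : contr_r (carrier (sumA A B)) xi ((inj_r _ _ \oxf \1)%VF t)
    = inj_r _ _ (contr_r _ xi t).
  rewrite -!comp_lfunE; congr (fun_of_lfun _ t); apply: tens_ext => p q.
  by rewrite !comp_lfunE tens_mapE !contr_rE !linearZ id_lfunE.
rewrite linearD; apply: etrans (congr2 +%R (h1 _) (h2 _)) _.
by rewrite inj_lE inj_rE; congr pair; rewrite /= ?addr0 ?add0r.
Qed.

Definition short_exact (A B C : objA)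
    (f : 'Hom(carrier A, carrier B)) (g : 'Hom(carrier B, carrier C)) : Prop :=
  [/\ homA f, homA g, (lker f == 0)%VS, (limg g == fullv)%VS
    & (limg f == lker g)%VS].

(* The Grothendieck group modulo zero representations, presented by           *)
(* generators and relations: formal group expressions in the classes of       *)
(* objects, up to the congruence generated by the abelian group axioms, the   *)
(* short exact sequences and [A] = 0 for zero representations A.              *)
Inductive gexpr : Type :=
  | Gcls of objA
  | Gzero
  | Gadd of gexpr & gexpr
  | Gopp of gexpr.

Inductive groth_eq : gexpr -> gexpr -> Prop :=
  | groth_refl a : groth_eq a a
  | groth_sym a b : groth_eq a b -> groth_eq b a
  | groth_trans a b c : groth_eq a b -> groth_eq b c -> groth_eq a c
  | groth_add a a' b b' : groth_eq a a' -> groth_eq b b' ->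
      groth_eq (Gadd a b) (Gadd a' b')
  | groth_opp a a' : groth_eq a a' -> groth_eq (Gopp a) (Gopp a')
  | groth_addA a b c : groth_eq (Gadd a (Gadd b c)) (Gadd (Gadd a b) c)
  | groth_addC a b : groth_eq (Gadd a b) (Gadd b a)
  | groth_add0 a : groth_eq (Gadd Gzero a) a
  | groth_addN a : groth_eq (Gadd (Gopp a) a) Gzero
  | groth_ses A B C f g :
      @short_exact A B C f g -> groth_eq (Gcls B) (Gadd (Gcls A) (Gcls C))
  | groth_zero_rep A : zero_rep A -> groth_eq (Gcls A) Gzero.

Definition K_projector (V : vectType K)
    (P : 'Hom((W \ox V)%type, (V \ox W)%type)) : Prop :=
  groth_eq (Gcls (tensA (ObjA P) (ObjA P))) (Gcls (ObjA P)).

Definition regular_K_projector (V : vectType K)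
    (P : 'Hom((W \ox V)%type, (V \ox W)%type)) : Prop :=
  [/\ K_projector P, irreducibleA (ObjA P)
    & exists V0 : objA, isoA (tensA (ObjA P) (ObjA P)) (sumA (ObjA P) V0)
                        /\ groth_eq (Gcls V0) Gzero].

End CategoryA.

Arguments Gzero {K W}.

Section WeakEnvelope.
Variable K : fieldType.

Record palgebra (V : vectType K) := PAlgebra {
  pmul : 'Hom((V \ox V)%type, V);
  pcomul : 'Hom(V, (V \ox V)%type);
  pmulA : (pmul \o (pmul \oxf \1) = pmul \o (\1 \oxf pmul) \o assoc_r V V V)%VF;
  pcomulA : (assoc_r V V V \o (pcomul \oxf \1) \o pcomul
             = (\1 \oxf pcomul) \o pcomul)%VF;
  pmulK : (pmul \o pcomul = \1)%VF
}.

(* The dual maps, with V^* (x) V^* identified with (V (x) V)^* by dual_tens.  *)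
Definition dual_mul (V : vectType K) (A : palgebra V) (x : dual V) :
    (dual V \ox dual V)%type :=
  ((dual_tens V V)^-1)%VF (x \o pmul A)%VF.

Lemma dual_mulE (V : vectType K) (A : palgebra V) (x : dual V) :
  dual_tens V V (dual_mul A x) = (x \o pmul A)%VF.
Proof. exact: dual_tens_invE. Qed.

Definition dual_comul (V : vectType K) (A : palgebra V)
    (t : (dual V \ox dual V)%type) : dual V :=
  (dual_tens V V t \o pcomul A)%VF.

(* A representation in W of the algebra generated by V (x) V^* subject to the *)
(* defining relations of the weak envelope is a linear map from V (x) V^* to  *)
(* End(W) satisfying these relations; the product is composition.             *)
Definition weak_envelope_rep (V W : vectType K) (A : palgebra V)
    (rho : 'Hom((V \ox dual V)%type, 'End(W))) : Prop :=
  (forall (u v : V) (x : dual V),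
     tens_lift (fun x' x'' : dual V => rho (u \oxv x'') \o rho (v \oxv x'))%VF
       (dual_mul A x)
     = rho (pmul A (v \oxv u) \oxv x)) /\
  (forall (u : V) (x y : dual V),
     tens_lift (fun u' u'' : V => rho (u'' \oxv x) \o rho (u' \oxv y))%VF
       (pcomul A u)
     = rho (u \oxv dual_comul A (y \oxv x))).

Definition rho_of (V W : vectType K)
    (P : 'Hom((W \ox V)%type, (V \ox W)%type)) :
    'Hom((V \ox dual V)%type, 'End(W)) :=
  tens_lift (fun (u : V) (x : dual V) =>
    linfun (fun w : W => contr_l W x (P (w \oxv u))) : 'End(W)).

Definition proj_of (V W : vectType K) n (e : n.-tuple V)
    (rho : 'Hom((V \ox dual V)%type, 'End(W))) :
    'Hom((W \ox V)%type, (V \ox W)%type) :=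
  tens_lift (fun (w : W) (u : V) =>
    \sum_(j < n) e`_j \oxv (rho (u \oxv dual_coord e j) w)).

Lemma rho_ofE (V W : vectType K) (P : 'Hom((W \ox V)%type, (V \ox W)%type))
    u x w :
  rho_of P (u \oxv x) w = contr_l W x (P (w \oxv u)).
Proof.
have l u' (x' : dual V) : linear (fun w : W => contr_l W x' (P (w \oxv u'))).
  by move=> a s t; rewrite pureDl !linearP.
rewrite tens_liftE; first by rewrite (linfunE (l u x)).
split=> [y|y] a s t; apply/lfunP=> z; rewrite add_lfunE scale_lfunE;
  rewrite !(fun u' x' => linfunE (l u' x')); last by rewrite pureDr !linearP.
rewrite -scale_lfunE -add_lfunE; congr (fun_of_lfun _ _).
apply: tens_ext => p q; rewrite add_lfunE scale_lfunE !contr_lE.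
by rewrite add_lfunE scale_lfunE scalerDl scalerA.
Qed.

Lemma proj_ofE (V W : vectType K) n (e : n.-tuple V)
    (rho : 'Hom((V \ox dual V)%type, 'End(W))) w u :
  proj_of e rho (w \oxv u)
  = \sum_(j < n) e`_j \oxv (rho (u \oxv dual_coord e j) w).
Proof.
rewrite tens_liftE //; split=> [y|y] a s t;
  rewrite scaler_sumr -big_split; apply: eq_bigr => j _ /=.
  by rewrite pureDl linearP add_lfunE scale_lfunE pureDr.
by rewrite linearP pureDr.
Qed.

End WeakEnvelope.

(* Main.v *)
(* The relations of the weak envelope say exactly that mu : V (x) V -> V and  *)
(* lambda : V -> V (x) V are morphisms of A_W (weak_envelope_repP), so (ii)   *)
(* and (iii) are formal. For (i), take mu and lambda to be the projection and *)
(* injection of V (x) V = V + V0. The trace of an element of the augmentation *)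
(* ideal is additive and vanishes on zero representations, so [V0] = 0 forces *)
(* all these traces on V0 and V0 (x) V to vanish; hence such elements act     *)
(* nilpotently there, whereas on the irreducible V, unless V is zero, some    *)
(* element of the ideal fixes a nonzero vector. So there are no nonzero       *)
(* morphisms between V and V0 or V0 (x) V, every morphism V (x) V (x) V -> V  *)
(* factors through mu (mu (x) 1), and Schur's lemma gives associativity up to *)
(* a scalar c; the pentagon forces c = 1. Coassociativity follows by the same *)
(* vanishing.                                                                 *)
Require Import Defs.
From HB Require Import structures.
From mathcomp Require Import all_boot all_order all_algebra.
From mathcomp Require Import boolp reals complex.

Set Implicit Arguments.
Unset Strict Implicit.
Unset Printing Implicit Defensive.

Import Order.TTheory GRing.Theory Num.Theory passmx.
Local Open Scope ring_scope.

(** The operators [rho_of P] on [W] and the actions on [V] have the same matrix coefficients, and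
    composition on one side is the tensor product of objects on the other ([rho_of_act],
    [rho_of_comp]). This is why the relations of the weak envelope amount to [pmul] and [pcomul]
    being morphisms ([weak_envelope_repP]). A basis expansion then gives (ii), and the retraction
    [mu \o la = 1] splits off a summand for (iii) ([split_summand]). The negative claims come from a
    flip, which acts by scalars, so that every linear map is a morphism. For (i), the projection
    [mu] and injection [la] of the summand [V] of [V \ox V] are morphisms, so only associativity and
    coassociativity are at stake. Traces of augmentation elements factor through the Grothendieck
    group ([groth_lftrace], [groth_lftrace_tens]). Hence these elements are nilpotent on [V0] and
    [V0 \ox V] ([traceless_nil]), whereas one of them fixes a nonzero vector of [V] unless [V] is a
    zero representation ([irreducible_aug_fix]). Morphisms between these objects and [V] therefore
    vanish. By [hom3_factor] and [schur] the two triple products are proportional, and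
    [assoc_scalar_eq1] computes the factor. *)

(** * Traces and nilpotent matrices *)

(** In a full-rank factorization A = CB, cancelling C on the left and B on the right of CBCB = CB
    gives BC = 1, whose size is the rank; and CB and BC have the same trace. *)
Lemma mxtrace_idem (K : fieldType) n (A : 'M[K]_n) :
  A *m A = A -> \tr A = (\rank A)%:R.
Proof.
move=> AA; have [L] := row_fullP (col_base_full A).
have [R] := row_freeP (row_base_free A); move: AA (mulmx_base A).
move: (col_base A) (row_base A) => C B AA CB BR LC.
have BC : B *m C = 1%:M.
  have : L *m (C *m (B *m C) *m B) *m R = L *m (C *m B) *m R.
    by congr (_ *m _ *m _); rewrite mulmxA CB -mulmxA CB AA.
  by rewrite !mulmxA LC !mul1mx -!mulmxA BR mulmx1.
by rewrite -{1}CB mxtrace_mulC BC mxtrace1.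
Qed.

(* Write the characteristic polynomial as X^m q with q(0) <> 0: the idempotent *)
(* with image that of A^(m+1) is a polynomial in A without constant term, so   *)
(* its rank vanishes together with its trace.                                  *)
Lemma mx_nilpotent (K : fieldType) n (A : 'M[K]_n.+1) : [pchar K] =i pred0 ->
  (forall p, \tr (A *m horner_mx A p) = 0) -> exists m, A ^+ m = 0.
Proof.
move=> K0 trA.
have p0 : char_poly A != 0 by rewrite -size_poly_eq0 size_char_poly.
have [m [q q0 pE]] := multiplicity_XsubC (char_poly A) 0.
rewrite p0 /= in q0.
rewrite subr0 in pE.
have cop : coprimep ('X^(m.+1)) q.
  by rewrite coprimep_expl // coprimep_sym coprimepX.
have /Bezout_eq1_coprimepP[[u v] /= uv] := cop.
have hA : horner_mx A ('X^(m.+1) * q) = 0.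
  by rewrite exprS -mulrA (mulrC _ q) -pE rmorphM /= Cayley_Hamilton mulr0.
(* The exponent is m+1 and not m so that a factor A splits off even when m = 0, as the trace
   hypothesis requires. *)
pose e := horner_mx A (u * 'X^(m.+1)).
have e1 : e = 1 - horner_mx A (v * q).
  by rewrite /e -[X in X - _](rmorph1 (horner_mx A)) -uv rmorphD addrK.
have ee : e *m e = e.
  rewrite {2}e1 mulmxBr mulmx1 [X in _ - X](_ : _ = 0) ?subr0 //.
  rewrite -[LHS]rmorphM /= mulrACA rmorphM /= hA.
  exact: mulr0.
have tre : \tr e = 0.
  by rewrite -(trA (u * 'X^m)) /e exprS mulrCA rmorphM /= horner_mx_X.
have e0 : e = 0.
  apply/eqP; rewrite -mxrank_eq0.
  by move/eqP: tre; rewrite mxtrace_idem // ((pcharf0P K).1 K0).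
exists m.+1; rewrite -[A in A ^+ _]horner_mx_X -rmorphXn /=.
rewrite -['X^_]mulr1 -uv mulrDr rmorphD [X in X + _]rmorphM /=.
by rewrite [horner_mx A (u * _)]e0 mulr0 add0r mulrCA rmorphM /= hA mulr0.
Qed.

(** * Expansions and separation of tensors *)

Section Tensors.
Variable K : fieldType.
Implicit Types U V W : vectType K.

Lemma vbasis_coord_sum V (v : V) :
  v = \sum_k (dual_coord (vbasis {:V}) k v : K) *: (vbasis {:V})`_k.
Proof.
by rewrite {1}(vbasis_sum v); apply: eq_bigr => k _; rewrite dual_coordE.
Qed.

Lemma dual_sep V (v v' : V) : (forall x : dual V, x v = x v') -> v = v'.
Proof.
move=> e; rewrite (vbasis_coord_sum v) (vbasis_coord_sum v').
by apply: eq_bigr => k _; rewrite e.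
Qed.

Lemma dual_tens_sep U V (s t : (U \ox V)%type) :
  (forall (x : dual U) (y : dual V),
     dual_tens U V (x \oxv y) s = dual_tens U V (x \oxv y) t) -> s = t.
Proof.
move=> e; apply: dual_sep => z; rewrite -(dual_splitK z) /dual_split.
rewrite !linear_sum !sum_lfunE; apply: eq_bigr => i _.
rewrite !linear_sum !sum_lfunE; apply: eq_bigr => j _.
by rewrite linearZ !scale_lfunE e.
Qed.

Lemma contr_r_sum V W (t : (V \ox W)%type) :
  t = \sum_k contr_r V (dual_coord (vbasis {:W}) k) t \oxv (vbasis {:W})`_k.
Proof.
have lin : linear (fun s : (V \ox W)%type => \sum_k
    contr_r V (dual_coord (vbasis {:W}) k) s \oxv (vbasis {:W})`_k).
  move=> a s r; rewrite scaler_sumr -big_split; apply: eq_bigr => k _ /=.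
  by rewrite linearP pureDl.
rewrite -[RHS](linfunE lin) -[LHS]id_lfunE; congr (fun_of_lfun _ t).
apply: tens_ext => v w; rewrite id_lfunE linfunE //.
rewrite {1}(vbasis_coord_sum w) (linear_fsum _ _ (pureDr _)).
apply: eq_bigr => k _.
by rewrite contr_rE (linear_fscale _ _ (pureDl _)).
Qed.

Lemma contr_l_sum V W n (e : n.-tuple V) (t : (V \ox W)%type) :
  basis_of {:V} e ->
  t = \sum_(j < n) e`_j \oxv contr_l W (dual_coord e j) t.
Proof.
move=> be.
have lin : linear (fun s : (V \ox W)%type => \sum_(j < n)
    e`_j \oxv contr_l W (dual_coord e j) s).
  move=> a s r; rewrite scaler_sumr -big_split; apply: eq_bigr => k _ /=.
  by rewrite linearP pureDr.
rewrite -[RHS](linfunE lin) -[LHS]id_lfunE; congr (fun_of_lfun _ t).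
apply: tens_ext => v w; rewrite id_lfunE linfunE //.
rewrite {1}(coord_basis be (memvf v)) (linear_fsum _ _ (pureDl _)).
apply: eq_bigr => k _.
by rewrite contr_lE (linear_fscale _ _ (pureDr _)) dual_coordE.
Qed.

Lemma dual_basis_sum V n (e : n.-tuple V) (x : dual V) :
  basis_of {:V} e -> x = \sum_(j < n) (x e`_j : K) *: dual_coord e j.
Proof.
move=> be; apply/lfunP => v; rewrite {1}(coord_basis be (memvf v)).
rewrite linear_sum sum_lfunE; apply: eq_bigr => j _.
by rewrite linearZ scale_lfunE dual_coordE /GRing.scale /= mulrC.
Qed.

Lemma contr_r_assoc_l U V W (xi : dual W) (u : U) (t : (V \ox W)%type) :
  contr_r (U \ox V)%type xi (assoc_l U V W (u \oxv t)) = u \oxv contr_r V xi t.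
Proof.
have l1 : linear (fun s : (V \ox W)%type =>
    contr_r (U \ox V)%type xi (assoc_l U V W (u \oxv s))).
  by move=> a s r; rewrite pureDr !linearP.
have l2 : linear (fun s : (V \ox W)%type => u \oxv contr_r V xi s).
  by move=> a s r; rewrite linearP pureDr.
rewrite -[LHS](linfunE l1) -[RHS](linfunE l2); congr (fun_of_lfun _ t).
apply: tens_ext => v w; rewrite (linfunE l1) (linfunE l2).
by rewrite assoc_lE !contr_rE (linear_fscale _ _ (pureDr _)).
Qed.

End Tensors.

(** * Morphisms and tensor products of objects *)

Section Morphisms.
Variables (K : fieldType) (W : vectType K).
Implicit Types A B C : objA W.

Lemma braid_sum A w (a : carrier A) :
  braid A (w \oxv a)
  = \sum_k act A w (dual_coord (vbasis {:W}) k) a \oxv (vbasis {:W})`_k.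
Proof.
by rewrite {1}(contr_r_sum (braid A _)); apply: eq_bigr => k _; rewrite actE.
Qed.

(** This is the matrix coproduct: [w] (x) [xi] goes to the sum over k of ([w] (x) e^k) (x) (e_k (x)
    [xi]), for a basis e_k of [W]. *)
Lemma act_tensA A B w xi (a : carrier A) (b : carrier B) :
  act (tensA A B) w xi (a \oxv b)
  = \sum_k act A w (dual_coord (vbasis {:W}) k) a
           \oxv act B (vbasis {:W})`_k xi b.
Proof.
rewrite actE /= !comp_lfunE assoc_lE tens_mapE id_lfunE braid_sum.
rewrite (linear_fsum0 _ (pureDl _)) !linear_sum /=.
apply: eq_bigr => k _.
by rewrite assoc_rE tens_mapE id_lfunE contr_r_assoc_l -actE.
Qed.

Lemma homA_id A : @homA K W A A \1%VF.
Proof. by move=> w xi v; rewrite !id_lfunE. Qed.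

Lemma homA_comp A B C (f : 'Hom(carrier B, carrier C))
    (g : 'Hom(carrier A, carrier B)) :
  homA f -> homA g -> @homA K W A C (f \o g)%VF.
Proof. by move=> hf hg w xi v; rewrite !comp_lfunE hg hf. Qed.

Lemma homA_tens A A' B B' (f : 'Hom(carrier A, carrier A'))
    (g : 'Hom(carrier B, carrier B')) :
  homA f -> homA g -> @homA K W (tensA A B) (tensA A' B') (f \oxf g)%VF.
Proof.
move=> hf hg w xi t.
pose F := (tens_map f g : 'Hom(carrier (tensA A B), carrier (tensA A' B'))).
suff /lfunP/(_ t) : (F \o act (tensA A B) w xi = act (tensA A' B') w xi \o F)%VF.
  by rewrite !comp_lfunE.
apply: tens_ext => a b; rewrite !comp_lfunE /F tens_mapE !act_tensA linear_sum.
by apply: eq_bigr => k _; rewrite /= tens_mapE hf hg.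
Qed.

Lemma homA_assoc_r A B C :
  @homA K W (tensA (tensA A B) C) (tensA A (tensA B C)) (assoc_r _ _ _).
Proof.
move=> w xi t.
pose F := (assoc_r _ _ _ :
  'Hom(carrier (tensA (tensA A B) C), carrier (tensA A (tensA B C)))).
suff /lfunP/(_ t) : (F \o act (tensA (tensA A B) C) w xi
    = act (tensA A (tensA B C)) w xi \o F)%VF by rewrite !comp_lfunE.
apply: tens_ext_l => a b c.
rewrite !comp_lfunE /F assoc_rE.
rewrite (act_tensA (A := tensA A B)) (act_tensA (B := tensA B C)) linear_sum.
under eq_bigr => k _ do
  rewrite act_tensA (linear_fsum0 _ (pureDl _)) linear_sum.
under [RHS]eq_bigr => k _ do rewrite act_tensA (linear_fsum0 _ (pureDr _)).
rewrite exchange_big /=; apply: eq_bigr => k _; apply: eq_bigr => l _.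
by rewrite assoc_rE.
Qed.

Lemma homA_assoc_l A B C :
  @homA K W (tensA A (tensA B C)) (tensA (tensA A B) C) (assoc_l _ _ _).
Proof.
move=> w xi t; rewrite -[in LHS](assoc_lK t).
by rewrite -[LHS](congr1 _ (homA_assoc_r _ _ _)) assoc_rK.
Qed.

Lemma zero_rep_tens A B : zero_rep A -> zero_rep (tensA A B).
Proof.
move=> zA w xi; apply: tens_ext => a b; rewrite act_tensA zero_lfunE big1 // => k _.
by rewrite zA zero_lfunE -(scale0r (0 : carrier A)) (linear_fscale _ _ (pureDl _)) scale0r.
Qed.

(* Traces of endomorphisms *)
End Morphisms.

Section Trace.
Variable K : fieldType.
Implicit Types U V : vectType K.

Definition lftrace V (F : 'End(V)) : K :=
  \tr (mxof (vbasis {:V}) (vbasis {:V}) F).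

Lemma lftrace0 V : lftrace (0 : 'End(V)) = 0.
Proof. by rewrite /lftrace linear0 mxtrace0. Qed.

Lemma lftraceD V (F G : 'End(V)) : lftrace (F + G) = lftrace F + lftrace G.
Proof. by rewrite /lftrace linearD mxtraceD. Qed.

Lemma lftrace1 V : lftrace (\1%VF : 'End(V)) = (\dim {:V})%:R.
Proof. by rewrite /lftrace mxof1 ?mxtrace1 ?(basis_free (vbasisP _)). Qed.

Lemma lftraceC U V (f : 'Hom(U, V)) (g : 'Hom(V, U)) :
  lftrace (f \o g)%VF = lftrace (g \o f)%VF.
Proof.
by rewrite /lftrace !(mxof_comp _ _ (vbasisP _)) mxtrace_mulC.
Qed.

(** [Q] contains A p(A) for every polynomial p, so [mx_nilpotent] applies. The power is written with
    [iter] because [n] may be zero, where matrices form no nontrivial ring. *)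
Lemma nil_of_traceless n (A : 'M[K]_n) (Q : 'M[K]_n -> Prop) :
    [pchar K] =i pred0 -> Q A ->
    (forall c M N, Q M -> Q N -> Q (c *: M + N)) ->
    (forall M N, Q M -> Q N -> Q (M *m N)) ->
    (forall M, Q M -> \tr M = 0) ->
  exists m, iter m (mulmx A) 1%:M = 0.
Proof.
move=> K0 QA Qlin Qmul Qtr.
case: n A Q QA Qlin Qmul Qtr => [|n] A Q QA Qlin Qmul Qtr.
  by exists 0; apply: flatmx0.
have Q0 : Q 0 by rewrite -(addNr A) -scaleN1r; apply: Qlin.
have [p|m Am] := @mx_nilpotent _ _ A K0.
  apply: Qtr; elim/poly_ind: p => [|p c IH]; first by rewrite rmorph0 mulmx0.
  rewrite rmorphD rmorphM /= horner_mx_X horner_mx_C mulmxDr addrC mul_mx_scalar.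
  by apply: Qlin => //; rewrite mulmxA; apply: Qmul.
exists m; rewrite -Am; elim: m {Am} => // m IH.
by rewrite iterS exprS -IH.
Qed.

Lemma rVof_iter V (F : 'End(V)) (e := vbasis {:V}) m v :
  rVof e (iter m F v) = rVof e v *m iter m (mulmx (mxof e e F)) 1%:M.
Proof.
elim: m v => [|m IH] v; first by rewrite mulmx1.
by rewrite iterSr IH (rVof_app _ (vbasisP _)) -mulmxA.
Qed.

End Trace.

(** * Traces as invariants of the Grothendieck group *)

Section Augmentation.
Variables (K : fieldType) (W : vectType K).
Implicit Types A B C : objA W.

(* The natural families of operators induced by the augmentation ideal of the *)
(* free algebra T^*(W (x) W^* ); they play the role of its elements.          *)
Inductive aug : (forall A, 'End(carrier A)) -> Prop :=
  | aug_act w xi : aug (fun A => act A w xi)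
  | aug_lin c a b : aug a -> aug b -> aug (fun A => c *: a A + b A)
  | aug_comp a b : aug a -> aug b -> aug (fun A => (a A \o b A)%VF).

Lemma aug_nat a A B (f : 'Hom(carrier A, carrier B)) v :
  aug a -> homA f -> f (a A v) = a B (f v).
Proof.
move=> ha hf; elim: ha v => {a} [w xi|c a b _ IHa _ IHb|a b _ IHa _ IHb] v.
- exact: hf.
- by rewrite !add_lfunE !scale_lfunE linearP /= IHa IHb.
- by rewrite !comp_lfunE IHa IHb.
Qed.

Lemma aug_zero a A : aug a -> zero_rep A -> a A = 0.
Proof.
move=> ha hA; elim: ha => {a} [w xi|c a b _ -> _ ->|a b _ -> _ _].
- exact: hA.
- by rewrite scaler0 addr0.
- exact: comp_lfun0l.
Qed.

(** The maps [r] and [s] need only be linear: naturality gives a_B = f a_A r + a_B s g, and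
    cyclicity of the trace turns the two terms into the traces of a_A and a_C. *)
Lemma lftrace_split A B C (f : 'Hom(carrier A, carrier B))
    (g : 'Hom(carrier B, carrier C)) (r : 'Hom(carrier B, carrier A))
    (s : 'Hom(carrier C, carrier B)) a :
    aug a -> homA f -> homA g -> cancel f r -> cancel s g ->
    (forall b, b = f (r b) + s (g b)) ->
  lftrace (a B) = lftrace (a A) + lftrace (a C).
Proof.
move=> ha hf hg fK sK dec.
have -> : a B = ((f \o (a A \o r)) + ((a B \o s) \o g))%VF.
  apply/lfunP => b; rewrite add_lfunE !comp_lfunE {1}(dec b) linearD.
  by rewrite (aug_nat _ ha hf).
rewrite lftraceD lftraceC (lftraceC _ g); congr (_ + _); congr lftrace.
  by apply/lfunP => v; rewrite !comp_lfunE fK.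
by apply/lfunP => v; rewrite !comp_lfunE (aug_nat _ ha hg) sK.
Qed.

Lemma short_exact_split A B C (f : 'Hom(carrier A, carrier B))
    (g : 'Hom(carrier B, carrier C)) : short_exact f g ->
  exists (r : 'Hom(carrier B, carrier A)) (s : 'Hom(carrier C, carrier B)),
    [/\ cancel f r, cancel s g & forall b, b = f (r b) + s (g b)].
Proof.
move=> [_ _ kf /eqP ig /eqP fg].
have sK : cancel g^-1%VF g by move=> c; rewrite limg_lfunVK // ig memvf.
have gf a : g (f a) = 0.
  by apply/eqP; rewrite -memv_ker -fg memv_img ?memvf.
exists (f^-1 \o (\1 - (g^-1 \o g)))%VF, (g^-1)%VF; split=> // [a|b].
  rewrite comp_lfunE add_lfunE opp_lfunE id_lfunE comp_lfunE gf linear0 subr0.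
  exact: lker0_lfunK.
rewrite comp_lfunE limg_lfunVK; last first.
  rewrite fg memv_ker add_lfunE opp_lfunE id_lfunE comp_lfunE linearB /= sK.
  by rewrite subrr.
by rewrite add_lfunE opp_lfunE id_lfunE comp_lfunE subrK.
Qed.

Fixpoint geval (tau : objA W -> K) (x : gexpr W) : K :=
  match x with
  | Gcls A => tau A
  | Gzero => 0
  | Gadd x y => geval tau x + geval tau y
  | Gopp x => - geval tau x
  end.

(** Universal property of the Grothendieck group modulo zero representations. *)
Lemma groth_geval tau :
    (forall A B C f g, @short_exact K W A B C f g -> tau B = tau A + tau C) ->
    (forall A, zero_rep A -> tau A = 0) ->
  forall x y, groth_eq x y -> geval tau x = geval tau y.
Proof.
move=> tD t0 x y; elim=> {x y} //=.
- by move=> x y z _ -> _ ->.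
- by move=> x x' y y' _ -> _ ->.
- by move=> x x' _ ->.
- by move=> x y z; rewrite addrA.
- by move=> x y; rewrite addrC.
- by move=> x; rewrite add0r.
- by move=> x; rewrite addNr.
Qed.

Lemma groth_lftrace a A : aug a -> groth_eq (Gcls A) Gzero ->
  lftrace (a A) = 0.
Proof.
move=> ha; apply: (groth_geval (tau := fun A => lftrace (a A))).
  move=> {}A B C f g fg; have [r [s [fK sK dec]]] := short_exact_split fg.
  by case: fg => hf hg _ _ _; apply: (lftrace_split ha hf hg fK sK dec).
by move=> {}A zA; rewrite aug_zero // lftrace0.
Qed.

(** Tensoring with [B] on the right is exact and preserves zero representations, so this trace is
    again an additive function of [A]. *)
Lemma groth_lftrace_tens a A B : aug a -> groth_eq (Gcls A) Gzero ->
  lftrace (a (tensA A B)) = 0.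
Proof.
move=> ha; apply: (groth_geval (tau := fun A => lftrace (a (tensA A B)))).
  move=> {}A A' C f g fg; have [r [s [fK sK dec]]] := short_exact_split fg.
  case: fg => hf hg _ _ _.
  have tK (U V : vectType K) (h : 'Hom(U, V)) (k : 'Hom(V, U)) : cancel h k ->
      cancel (h \oxf \1 : 'Hom((U \ox carrier B)%type, (V \ox carrier B)%type))%VF
        (k \oxf \1)%VF.
    move=> hK t; rewrite -comp_lfunE -[RHS]id_lfunE; congr (fun_of_lfun _ t).
    by apply: tens_ext => u b; rewrite comp_lfunE !tens_mapE !id_lfunE hK.
  apply: (@lftrace_split (tensA A B) (tensA A' B) (tensA C B)
    (f \oxf \1)%VF (g \oxf \1)%VF (r \oxf \1)%VF (s \oxf \1)%VF) => //.
  - by apply: homA_tens; last apply: homA_id.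
  - by apply: homA_tens; last apply: homA_id.
  - exact: tK.
  - exact: tK.
  - move=> t; rewrite -!comp_lfunE -add_lfunE -[LHS]id_lfunE.
    congr (fun_of_lfun _ t); apply: tens_ext => u b.
    rewrite add_lfunE !comp_lfunE !tens_mapE !id_lfunE -[X in X + _]scale1r.
    by rewrite -pureDl scale1r -dec.
by move=> {}A zA; rewrite aug_zero ?lftrace0 //; apply: zero_rep_tens.
Qed.

End Augmentation.

(** * Irreducible objects: vanishing of morphisms and Schur's lemma *)

Section Irreducible.
Variable K : numClosedFieldType.

(** Lets irreducibility be applied to images, kernels and eigenspaces given as predicates. A
    subspace inside [Q] is enlarged by missing vectors, by induction on a bound for its
    codimension. *)
Lemma vspace_of_pred (V : vectType K) (Q : V -> Prop) :
    Q 0 -> (forall c u v, Q u -> Q v -> Q (c *: u + v)) ->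
  exists U : {vspace V}, forall x, x \in U <-> Q x.
Proof.
move=> Q0 Qlin.
suff grow k (U : {vspace V}) : (forall x, x \in U -> Q x) ->
    (\dim {:V} - \dim U <= k)%N -> exists U : {vspace V}, forall x, x \in U <-> Q x.
  by apply: (grow _ 0%VS _ (leqnn _)) => x; rewrite memv0 => /eqP ->.
elim: k U => [|k IH] U UQ dU;
  have [[x [Qx xU]]|noQ] := pselect (exists x, Q x /\ x \notin U).
- rewrite leqn0 subn_eq0 in dU; have : U == fullv by rewrite eqEdim subvf.
  by move/eqP=> Uf; rewrite Uf memvf in xU.
- exists U => x; split=> [/UQ//|Qx]; apply/negPn/negP => xU.
  by apply: noQ; exists x.
- apply: (IH (U + <[x]>)%VS) => [y /memv_addP[u uU [_ /vlineP[c ->] ->]]|].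
    by rewrite addrC; apply: Qlin => //; apply: UQ.
  have ltU : (\dim U < \dim (U + <[x]>))%N.
    rewrite (ltn_leqif (dimv_leqif_sup (addvSl U <[x]>))) subv_add subvv.
    by rewrite -memvE.
  rewrite leq_subLR (leq_trans _ (leq_add ltU (leqnn k))) //.
  by rewrite addSnnS -leq_subLR.
- exists U => x; split=> [/UQ//|Qx]; apply/negPn/negP => xU.
  by apply: noQ; exists x.
Qed.

Variable W : vectType K.
Implicit Types N V : objA W.

Lemma irreducible_pred V (Q : carrier V -> Prop) : irreducibleA V ->
    Q 0 -> (forall c u v, Q u -> Q v -> Q (c *: u + v)) ->
    (forall w xi v, Q v -> Q (act V w xi v)) ->
  (forall v, Q v -> v = 0) \/ (forall v, Q v).
Proof.
move=> [_ irrV] Q0 Qlin Qact; have [U UQ] := vspace_of_pred Q0 Qlin.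
have [w xi||] := irrV U.
- by apply/subvP => _ /memv_imgP[v /UQ Qv ->]; apply/UQ/Qact.
- by move=> U0; left=> v /UQ; rewrite U0 memv0 => /eqP.
- by move=> Uf; right=> v; apply/UQ; rewrite Uf memvf.
Qed.

Lemma irreducible_neq0 V : irreducibleA V -> exists v : carrier V, v != 0.
Proof. by case=> V0 _; exists (vpick {:carrier V}); rewrite vpick0. Qed.

(** For a [v] not killed by the action, the vectors a v with [a] in the augmentation ideal form a
    nonzero invariant subspace, hence all of [V], and in particular contain [v]. *)
Lemma irreducible_aug_fix V : irreducibleA V -> ~ zero_rep V ->
  exists a v, [/\ aug a, v != 0 & a V v = v].
Proof.
move=> irrV nzV.
have [[w [xi [v nz]]]|z] := pselect (exists w xi v, act V w xi v <> 0); last first.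
  case: nzV => w xi; apply/lfunP => v; rewrite zero_lfunE.
  by apply: contrapT => nz; apply: z; exists w, xi, v.
pose Q x := exists2 a, aug a & a V v = x.
have [|c _ _ [a ha <-] [b hb <-]|w' xi' _ [a ha <-]|Q0|QT] :=
    irreducible_pred (Q := Q) irrV.
- exists (fun A => (-1) *: act A w xi + act A w xi); last first.
    by rewrite add_lfunE scale_lfunE scaleN1r addNr.
  by apply: aug_lin; apply: aug_act.
- exists (fun A => c *: a A + b A); first exact: aug_lin.
  by rewrite add_lfunE scale_lfunE.
- exists (fun A => act A w' xi' \o a A)%VF; last by rewrite comp_lfunE.
  by apply: aug_comp => //; apply: aug_act.
- by case: nz; apply: Q0; exists (fun A => act A w xi) => //; apply: aug_act.
- have [a ha av] := QT v; exists a, v; split=> //.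
  by apply/eqP => v0; apply: nz; rewrite v0 linear0.
Qed.

Lemma traceless_nil N a : (forall b, aug b -> lftrace (b N) = 0) -> aug a ->
  exists m, forall x, iter m (a N) x = 0.
Proof.
move=> trN ha.
pose e := vbasis {:carrier N}; pose mx F := mxof e e F.
have [|||||m am] :=
    @nil_of_traceless K _ (mx (a N)) (fun M => exists2 b, aug b & mx (b N) = M).
- exact: pchar_num.
- by exists a.
- move=> c _ _ [b hb <-] [b' hb' <-]; exists (fun A => c *: b A + b' A).
    exact: aug_lin.
  by rewrite /mx linearP.
- move=> _ _ [b hb <-] [b' hb' <-]; exists (fun A => b' A \o b A)%VF.
    exact: aug_comp.
  by rewrite /mx (mxof_comp _ _ (vbasisP _)).
- by move=> _ [b hb <-]; apply: trN.
- exists m => x; apply/eqP; rewrite -(rVof_eq0 (vbasisP _)) rVof_iter.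
  by rewrite [iter _ _ _]am mulmx0.
Qed.

(** Otherwise [f] is onto, and a vector f x fixed by [a] equals f (a^m x), which is 0 for large
    m. *)
Lemma hom_to_irreducible N V (f : 'Hom(carrier N, carrier V)) :
    (forall b, aug b -> lftrace (b N) = 0) -> irreducibleA V -> ~ zero_rep V ->
  homA f -> f = 0.
Proof.
move=> trN irrV nzV hf; have [a [v [ha v0 av]]] := irreducible_aug_fix irrV nzV.
have [m am] := traceless_nil trN ha.
have [|c u1 u2 [x1 <-] [x2 <-]|w xi _ [x <-]|f0|/(_ v)[x fx]] :=
    irreducible_pred (Q := fun u => exists x, f x = u) irrV.
- by exists 0; rewrite linear0.
- by exists (c *: x1 + x2); rewrite linearP.
- by exists (act N w xi x).
- by apply/lfunP => x; rewrite zero_lfunE; apply: f0; exists x.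
have : f (iter m (a N) x) = v.
  by elim: m {am} => //= m IH; rewrite (aug_nat _ ha hf) IH.
by rewrite am linear0 => vE; rewrite -vE eqxx in v0.
Qed.

(** Otherwise [f] is injective, yet it sends a vector fixed by [a] into a space where [a] is
    nilpotent. *)
Lemma hom_from_irreducible N V (f : 'Hom(carrier V, carrier N)) :
    (forall b, aug b -> lftrace (b N) = 0) -> irreducibleA V -> ~ zero_rep V ->
  homA f -> f = 0.
Proof.
move=> trN irrV nzV hf; have [a [v [ha v0 av]]] := irreducible_aug_fix irrV nzV.
have [m am] := traceless_nil trN ha.
have [|c u1 u2 f1 f2|w xi u fu|inj|f0] :=
    irreducible_pred (Q := fun u => f u = 0) irrV.
- by rewrite linear0.
- by rewrite linearP /= f1 f2 scaler0 addr0.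
- by rewrite hf fu linear0.
- have : f v = iter m (a N) (f v).
    by elim: m {am} => //= m IH; rewrite -IH -(aug_nat _ ha hf) av.
  by rewrite am => /inj vE; rewrite vE eqxx in v0.
- by apply/lfunP => u; rewrite zero_lfunE.
Qed.

Lemma schur V (h : 'End(carrier V)) : irreducibleA V -> homA h ->
  exists c, forall v, h v = c *: v.
Proof.
move=> irrV hh; pose e := vbasis {:carrier V}.
have dV : (0 < \dim {:carrier V})%N by rewrite lt0n dimv_eq0; case: irrV.
have [c /eigenvalueP[r rh r0]] := eigenvalue_closed (mxof e e h) dV.
exists c.
have [|d u1 u2 h1 h2|w xi u hu|h0|//] :=
    irreducible_pred (Q := fun u => h u = c *: u) irrV.
- by rewrite linear0 scaler0.
- by rewrite linearP /= h1 h2 scalerDr !scalerA mulrC.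
- by rewrite hh hu linearZ.
have : vecof e r = 0.
  by apply: h0; rewrite (hom_vecof _ (vbasisP _)) rh linearZ.
by move/eqP; rewrite (vecof_eq0 (vbasisP _)) (negPf r0).
Qed.

End Irreducible.

(** * The weak envelope relations as morphism conditions *)

Section WeakEnvelopeHom.
Variables (K : fieldType) (V W : vectType K).
Variable P : 'Hom((W \ox V)%type, (V \ox W)%type).
Let A := ObjA P.

Lemma contr_lrC (x : dual V) (xi : dual W) (t : (V \ox W)%type) :
  xi (contr_l W x t) = x (contr_r V xi t).
Proof.
rewrite -!comp_lfunE; congr (fun_of_lfun _ t); apply: tens_ext => v w.
by rewrite !comp_lfunE contr_lE contr_rE !linearZ /= /GRing.scale /= mulrC.
Qed.

Lemma rho_of_act u (x : dual V) w (xi : dual W) :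
  xi (rho_of P (u \oxv x) w) = x (act A w xi u).
Proof. by rewrite rho_ofE actE contr_lrC. Qed.

Lemma act_linear_l xi (v : V) : linear (fun w => act A w xi v).
Proof. by move=> a w w'; rewrite !actE pureDl !linearP. Qed.

(** The basis of [W] inserted between the two operators is the one summed over in [act_tensA]. The
    order of the factors is reversed, which accounts for the flipped indices in the relations of the
    weak envelope. *)
Lemma rho_of_comp u v (x y : dual V) w (xi : dual W) :
  xi ((rho_of P (u \oxv y) \o rho_of P (v \oxv x))%VF w)
  = dual_tens V V (x \oxv y) (act (tensA A A) w xi (v \oxv u)).
Proof.
rewrite comp_lfunE rho_of_act (vbasis_coord_sum (rho_of P _ w)).
rewrite (linear_fsum _ _ (act_linear_l _ _)) act_tensA !linear_sum /=.
apply: eq_bigr => k _.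
by rewrite linearZ /= dual_tensE rho_of_act.
Qed.

Lemma rho_of_bilin_dual u v : bilin (fun x y : dual V =>
  (rho_of P (u \oxv y) \o rho_of P (v \oxv x))%VF).
Proof.
split=> z c s t /=; rewrite pureDr linearP.
  by rewrite comp_lfunDl comp_lfunZl.
by rewrite comp_lfunDr comp_lfunZr.
Qed.

Lemma rho_of_bilin x y : bilin (fun u v : V =>
  (rho_of P (v \oxv x) \o rho_of P (u \oxv y))%VF).
Proof.
split=> z c s t /=; rewrite pureDl linearP.
  by rewrite comp_lfunDl comp_lfunZl.
by rewrite comp_lfunDr comp_lfunZr.
Qed.

Lemma rho_of_lift_dual u v (t : (dual V \ox dual V)%type) w (xi : dual W) :
  xi (tens_lift (fun x y : dual V =>
        rho_of P (u \oxv y) \o rho_of P (v \oxv x))%VF t w)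
  = dual_tens V V t (act (tensA A A) w xi (v \oxv u)).
Proof.
pose L := tens_lift (fun x y : dual V =>
  (rho_of P (u \oxv y) \o rho_of P (v \oxv x))%VF).
have l1 : linear (fun s => xi (L s w) : K^o).
  by move=> c s r; rewrite !linearP add_lfunE scale_lfunE linearP.
have l2 : linear (fun s => dual_tens V V s (act (tensA A A) w xi (v \oxv u)) : K^o).
  by move=> c s r; rewrite linearP add_lfunE scale_lfunE.
rewrite -[LHS](linfunE l1) -[RHS](linfunE l2); congr (fun_of_lfun _ t).
apply: tens_ext => x y; rewrite (linfunE l1) (linfunE l2) -rho_of_comp /L.
by rewrite tens_liftE //; apply: rho_of_bilin_dual.
Qed.

Lemma rho_of_lift (x y : dual V) (t : (V \ox V)%type) w (xi : dual W) :
  xi (tens_lift (fun u v : V =>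
        rho_of P (v \oxv x) \o rho_of P (u \oxv y))%VF t w)
  = dual_tens V V (y \oxv x) (act (tensA A A) w xi t).
Proof.
pose L := tens_lift (fun u v : V =>
  (rho_of P (v \oxv x) \o rho_of P (u \oxv y))%VF).
have l1 : linear (fun s => xi (L s w) : K^o).
  by move=> c s r; rewrite linearP add_lfunE scale_lfunE linearP.
have l2 : linear (fun s => dual_tens V V (y \oxv x) (act (tensA A A) w xi s) : K^o).
  by move=> c s r; rewrite !linearP.
rewrite -[LHS](linfunE l1) -[RHS](linfunE l2); congr (fun_of_lfun _ t).
apply: tens_ext => u v; rewrite (linfunE l1) (linfunE l2) -rho_of_comp /L.
by rewrite tens_liftE //; apply: rho_of_bilin.
Qed.

Lemma weak_envelope_repP (M : palgebra V) :
  weak_envelope_rep M (rho_of P) <->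
  @homA K W (tensA A A) A (pmul M) /\ @homA K W A (tensA A A) (pcomul M).
Proof.
split=> [[rmul rcomul]|[hmul hcomul]]; split.
- move=> w xi t.
  suff /lfunP/(_ t) : (pmul M \o act (tensA A A) w xi
      = act A w xi \o pmul M :> 'Hom((V \ox V)%type, V))%VF.
    by rewrite !comp_lfunE.
  apply: tens_ext => v u; rewrite !comp_lfunE; apply: dual_sep => x.
  rewrite -rho_of_act -rmul rho_of_lift_dual dual_mulE.
  by rewrite comp_lfunE.
- move=> w xi u; apply: dual_tens_sep => y x.
  rewrite -rho_of_lift rcomul rho_of_act /dual_comul.
  by rewrite comp_lfunE.
- move=> u v x; apply/lfunP => w; apply: dual_sep => xi.
  rewrite rho_of_lift_dual rho_of_act dual_mulE comp_lfunE.
  by rewrite -[in RHS]hmul.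
- move=> u x y; apply/lfunP => w; apply: dual_sep => xi.
  rewrite rho_of_lift rho_of_act /dual_comul comp_lfunE.
  by rewrite -[in LHS]hcomul.
Qed.

Lemma rho_of_expansion n (e : n.-tuple V) : basis_of {:V} e ->
  forall w u, P (w \oxv u)
    = \sum_(j < n) e`_j \oxv rho_of P (u \oxv dual_coord e j) w.
Proof.
move=> be w u; rewrite {1}(contr_l_sum (P _) be).
by apply: eq_bigr => j _; rewrite rho_ofE.
Qed.

End WeakEnvelopeHom.

Lemma rho_of_proj_of (K : fieldType) (V W : vectType K) n (e : n.-tuple V)
    (rho : 'Hom((V \ox dual V)%type, 'End(W))) :
  basis_of {:V} e -> rho_of (proj_of e rho) = rho.
Proof.
move=> be; apply: tens_ext => u x; apply/lfunP => w.
rewrite rho_ofE proj_ofE linear_sum /= [in RHS](dual_basis_sum x be).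
rewrite (linear_fsum _ _ (pureDr _)) linear_sum sum_lfunE.
by apply: eq_bigr => j _; rewrite contr_lE linearZ scale_lfunE.
Qed.

(** * Direct summands of objects *)

Section Splitting.
Variables (K : fieldType) (W : vectType K).
Implicit Types A B : objA W.

Lemma act_retract B (X : vectType K) (i : 'Hom(X, carrier B))
    (p : 'Hom(carrier B, X))
    (C := @ObjA K W X ((p \oxf \1) \o braid B \o (\1 \oxf i))%VF) w xi x :
  act C w xi x = p (act B w xi (i x)).
Proof.
rewrite actE /= !comp_lfunE tens_mapE id_lfunE actE.
rewrite -[RHS]comp_lfunE -[LHS]comp_lfunE; congr (fun_of_lfun _ _).
apply: tens_ext => v w'; rewrite !comp_lfunE tens_mapE id_lfunE !contr_rE.
by rewrite linearZ.
Qed.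

Lemma split_summand A B (f : 'Hom(carrier B, carrier A))
    (g : 'Hom(carrier A, carrier B)) :
  homA f -> homA g -> cancel g f -> exists V0, isoA B (sumA A V0).
Proof.
move=> hf hg gK; pose U := lker f; pose q := (\1 - (g \o f))%VF.
have qE b : q b = b - g (f b).
  by rewrite add_lfunE opp_lfunE id_lfunE comp_lfunE.
have qU b : q b \in U by rewrite memv_ker qE linearB /= gK subrr.
pose i : 'Hom(subvs_of U, carrier B) := linfun vsval.
pose p : 'Hom(carrier B, subvs_of U) := (linfun (vsproj U) \o q)%VF.
have iE x : i x = vsval x by rewrite lfunE.
have fi x : f (i x) = 0 by apply/eqP; rewrite iE -memv_ker subvsP.
have ip b : i (p b) = b - g (f b).
  by rewrite iE comp_lfunE lfunE /= vsprojK // qE.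
have pi x : p (i x) = x.
  by apply: subvs_inj; rewrite -iE ip fi linear0 subr0 iE.
have pg a : p (g a) = 0.
  by apply: subvs_inj; rewrite -iE ip gK subrr.
(* The complement is the kernel of [f], with the map of [B] compressed to it by the projection 1 - g
   f. *)
pose V0 := @ObjA K W (subvs_of U) ((p \oxf \1) \o braid B \o (\1 \oxf i))%VF.
have a0 w xi x : act V0 w xi x = p (act B w xi (i x)) by exact: act_retract.
have lF : linear (fun b : carrier B => (f b, p b)).
  by move=> c s t; congr pair; rewrite linearP.
have lG : linear (fun z : (carrier A * subvs_of U)%type => g z.1 + i z.2).
  by move=> c s t; rewrite /= !linearP scalerDr addrACA.
exists V0.
exists (linfun (fun b => (f b, p b)) : 'Hom(_, carrier (sumA A V0))).
exists (linfun (fun z : (carrier A * subvs_of U)%type => g z.1 + i z.2)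
  : 'Hom(carrier (sumA A V0), _)); split.
- move=> w xi b; rewrite !(linfunE lF) act_sumA hf a0 ip.
  by rewrite !linearB /= -hg pg subr0.
- move=> w xi [a x]; rewrite act_sumA !(linfunE lG) /= a0 ip hf fi.
  by rewrite !linear0 addr0 hg linearD.
- by move=> b; rewrite (linfunE lF) (linfunE lG) /= ip addrC subrK.
- move=> [a x]; rewrite (linfunE lG) (linfunE lF) /= !linearD /=.
  by rewrite gK fi pg pi addr0 add0r.
Qed.

Lemma iso_sum_decomposition A B C : isoA B (sumA A C) ->
  exists (mu : 'Hom(carrier B, carrier A)) (p : 'Hom(carrier B, carrier C))
         (la : 'Hom(carrier A, carrier B)) (i : 'Hom(carrier C, carrier B)),
    [/\ homA mu, homA p, homA la, homA i &
        [/\ cancel la mu, cancel i p & forall t, t = la (mu t) + i (p t)]].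
Proof.
move=> [f [g [hf hg fK gK]]].
have l1 : linear (fun t => (f t).1) by move=> c s t; rewrite linearP.
have l2 : linear (fun t => (f t).2) by move=> c s t; rewrite linearP.
have l3 : linear (fun v => g (v, 0)).
  move=> c s t; rewrite -linearP; congr (g _).
  by congr pair; rewrite /= scaler0 addr0.
have l4 : linear (fun v => g (0, v)).
  move=> c s t; rewrite -linearP; congr (g _).
  by congr pair; rewrite /= scaler0 addr0.
exists (linfun (fun t => (f t).1)), (linfun (fun t => (f t).2)).
exists (linfun (fun v => g (v, 0))), (linfun (fun v => g (0, v))).
split.
- move=> w xi t; rewrite !(linfunE l1) hf; case: (f t) => a b.
  by rewrite act_sumA.
- move=> w xi t; rewrite !(linfunE l2) hf; case: (f t) => a b.
  by rewrite act_sumA.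
- by move=> w xi v; rewrite !(linfunE l3) -hg act_sumA linear0.
- by move=> w xi v; rewrite !(linfunE l4) -hg act_sumA linear0.
split=> [v|v|t].
- by rewrite (linfunE l3) (linfunE l1) gK.
- by rewrite (linfunE l4) (linfunE l2) gK.
rewrite (linfunE l1) (linfunE l2) (linfunE l3) (linfunE l4) -linearD -[LHS]fK.
by congr (g _); case: (f t) => a b; congr pair; rewrite /= ?addr0 ?add0r.
Qed.

Lemma lftrace_iso_sum A B C a : aug a -> isoA B (sumA A C) ->
  lftrace (a B) = lftrace (a A) + lftrace (a C).
Proof.
move=> ha /iso_sum_decomposition[mu [p [la [i [hmu hp hla hi [muK pK dec]]]]]].
exact: (lftrace_split ha hla hp muK pK dec).
Qed.

End Splitting.

(* Comparing the two ways of rewriting a(b(cd)) into ((ab)c)d, as in Mac      *)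
(* Lane's pentagon, gives c ^ 2 = c ^ 3.                                      *)
Lemma assoc_scalar_eq1 (K : fieldType) (V : vectType K)
    (mu : 'Hom((V \ox V)%type, V)) (la : 'Hom(V, (V \ox V)%type)) (c : K)
    (v : V) : cancel la mu -> v != 0 ->
    (forall x y z, mu (x \oxv mu (y \oxv z)) = c *: mu (mu (x \oxv y) \oxv z)) ->
  c = 1.
Proof.
move=> muK v0 muA.
(* [mu] is onto, so a linear map that kills all products is zero. *)
have mu_l0 (h : V -> V) : linear h -> (forall x y, h (mu (x \oxv y)) = 0) ->
    forall x, h x = 0.
  move=> lh h0 x; rewrite -(muK x) -(linfunE lh) -comp_lfunE.
  rewrite (_ : (_ \o _)%VF = 0) ?zero_lfunE //; apply: tens_ext => y z.
  by rewrite comp_lfunE linfunE // zero_lfunE.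
have lin_mul z : linear (fun x => mu (x \oxv z)).
  by move=> a x y; rewrite pureDl linearP.
have lin_mulr z : linear (fun x => mu (z \oxv x)).
  by move=> a x y; rewrite pureDr linearP.
have lin_id : linear (fun x : V => x) by [].
have mulZr a x y : mu (x \oxv (a *: y)) = a *: mu (x \oxv y).
  by rewrite (linear_fscale _ _ (lin_mulr x)).
have mulZl a x y : mu ((a *: x) \oxv y) = a *: mu (x \oxv y).
  by rewrite (linear_fscale _ _ (lin_mul y)).
have c0 : c != 0.
  apply/eqP => c0; move/eqP: v0; apply.
  apply: (mu_l0 _ lin_id) => x y.
  by apply: (mu_l0 _ (lin_mulr x)) => y1 y2; rewrite muA c0 scale0r.
(* Through (xy)(zt) two moves are needed; through x((yz)t) and (x(yz))t, three. *)
have cE x y z t : (c ^+ 2 - c ^+ 3) *: mu (mu (mu (x \oxv y) \oxv z) \oxv t) = 0.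
  rewrite scalerBl; apply/eqP; rewrite subr_eq0; apply/eqP.
  transitivity (mu (x \oxv mu (y \oxv mu (z \oxv t)))).
    by rewrite !muA scalerA.
  by rewrite (muA y) mulZr (muA x) muA mulZl !scalerA !exprS expr0 mulr1 mulrA.
have : c ^+ 2 - c ^+ 3 = 0.
  apply: contraNeq v0 => d0; apply/eqP; apply: (mu_l0 _ lin_id) => x t.
  apply: (mu_l0 _ (lin_mul t)) => {}x z; apply: (mu_l0 (fun x => mu (mu (x \oxv z) \oxv t))).
    by move=> a x1 x2; rewrite !(pureDl, linearP).
  move=> {}x y; apply/eqP; move/eqP: (cE x y z t).
  by rewrite scaler_eq0 (negPf d0).
move/eqP; rewrite subr_eq0 [c ^+ 3]exprSr -{1}[c ^+ 2]mulr1.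
by move/eqP/mulfI => <- //; rewrite expf_neq0.
Qed.

(** * From regular K-projectors to P-algebras *)

Section RegularProjector.
Variables (K : numClosedFieldType) (W : vectType K).
Implicit Types A : objA W.

Lemma zero_irreducible_line A : irreducibleA A -> zero_rep A ->
  forall v : carrier A, v != 0 -> forall u, exists c, u = c *: v.
Proof.
move=> irrA zA v v0.
have [|c _ _ [c1 ->] [c2 ->]|w xi u _|Q0|//] :=
    irreducible_pred (Q := fun u => exists c, u = c *: v) irrA.
- by exists 0; rewrite scale0r.
- by exists (c * c1 + c2); rewrite scalerDl scalerA.
- by exists 0; rewrite zA zero_lfunE scale0r.
- by move/eqP: v0; case; apply: Q0; exists 1; rewrite scale1r.
Qed.

Section Decomposition.
Variables (A V0 : objA W).
Variables (mu : 'Hom((carrier A \ox carrier A)%type, carrier A))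
  (la : 'Hom(carrier A, (carrier A \ox carrier A)%type))
  (p : 'Hom((carrier A \ox carrier A)%type, carrier V0))
  (i : 'Hom(carrier V0, (carrier A \ox carrier A)%type)).
Hypotheses (hmu : @homA K W (tensA A A) A mu) (hla : @homA K W A (tensA A A) la)
  (hp : @homA K W (tensA A A) V0 p) (hi : @homA K W V0 (tensA A A) i).
Hypotheses (muK : cancel la mu) (pK : cancel i p).
Hypothesis dec : forall t, t = la (mu t) + i (p t).
Hypotheses (irrA : irreducibleA A) (V0z : groth_eq (Gcls V0) Gzero).

Lemma mu_compl x : mu (i x) = 0.
Proof.
have := congr1 mu (dec (i x)); rewrite pK linearD /= muK => /eqP.
by rewrite -subr_eq subrr eq_sym => /eqP.
Qed.

(** Settles the case where no augmentation element fixes a nonzero vector: [A] is then a line, so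
    [A \ox A] is one too and is exhausted by the image of [la]. *)
Lemma zero_rep_compl : zero_rep A -> forall x : carrier V0, x = 0.
Proof.
move=> zA x; have [v v0] := irreducible_neq0 irrA.
have line := zero_irreducible_line irrA zA v0.
have linet (t : (carrier A \ox carrier A)%type) : exists c, t = c *: (v \oxv v).
  rewrite (tens_sum t); apply: (big_ind (fun t => exists c, t = c *: (v \oxv v))).
  - by exists 0; rewrite scale0r.
  - by move=> _ _ [c ->] [d ->]; exists (c + d); rewrite scalerDl.
  move=> k _; have [c ->] := line (vbasis {:carrier A})`_k.
  have [d ->] := line (t (dual_coord (vbasis {:carrier A}) k)).
  exists (c * d); rewrite (linear_fscale _ _ (pureDl _)).
  by rewrite (linear_fscale _ _ (pureDr _)) scalerA.
have [d ld] := linet (la v); have [k ik] := linet (i x).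
have d0 : d != 0.
  by apply: contraNneq v0 => d0; rewrite -(muK v) ld d0 scale0r linear0.
have ix : i x = la ((k / d) *: v) by rewrite linearZ /= ld scalerA divfK.
by rewrite -(pK x) ix -(muK (_ *: v)) -ix mu_compl !linear0.
Qed.

Lemma hom_compl_l (f : 'Hom(carrier V0, carrier A)) : homA f -> f = 0.
Proof.
move=> hf; have [zA|nzA] := pselect (zero_rep A).
  by apply/lfunP => x; rewrite (zero_rep_compl zA x) !linear0.
by apply: hom_to_irreducible hf => // b hb; apply: groth_lftrace.
Qed.

Lemma hom_compl_r (f : 'Hom(carrier A, carrier V0)) : homA f -> f = 0.
Proof.
move=> hf; have [zA|nzA] := pselect (zero_rep A).
  by apply/lfunP => x; rewrite zero_lfunE; apply: zero_rep_compl.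
by apply: hom_from_irreducible hf => // b hb; apply: groth_lftrace.
Qed.

Lemma hom_compl_tens_l (f : 'Hom((carrier V0 \ox carrier A)%type, carrier A)) :
  @homA K W (tensA V0 A) A f -> f = 0.
Proof.
move=> hf; have [zA|nzA] := pselect (zero_rep A).
  apply: tens_ext => x v; rewrite (zero_rep_compl zA x) zero_lfunE.
  by rewrite -(scale0r (0 : carrier V0)) (linear_fscale _ _ (pureDl _)) scale0r linear0.
apply: (@hom_to_irreducible _ _ (tensA V0 A)) hf => // b hb.
exact: groth_lftrace_tens.
Qed.

Lemma hom_compl_tens_r (f : 'Hom(carrier A, (carrier V0 \ox carrier A)%type)) :
  @homA K W A (tensA V0 A) f -> f = 0.
Proof.
move=> hf; have [zA|nzA] := pselect (zero_rep A).
  apply/lfunP => v; rewrite zero_lfunE (tens_sum (f v)) big1 // => k _.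
  rewrite (zero_rep_compl zA (vbasis _)`_k) -(scale0r (0 : carrier V0)).
  by rewrite (linear_fscale _ _ (pureDl _)) scale0r.
apply: (@hom_from_irreducible _ _ (tensA V0 A)) hf => // b hb.
exact: groth_lftrace_tens.
Qed.

Let T3 := tensA (tensA A A) A.

(** Splitting [A \ox A] twice decomposes [T3] into [A], [V0] and [V0 \ox A]; [f] vanishes on the
    last two. *)
Lemma hom3_factor (f : 'Hom(carrier T3, carrier A)) : homA f ->
  exists2 h : 'End(carrier A), homA h &
    forall t v, f (t \oxv v) = h (mu (mu t \oxv v)).
Proof.
move=> hf; pose k := (f \o (la \oxf \1))%VF.
have hk : @homA K W (tensA A A) A k.
  apply: (@homA_comp _ _ (tensA A A) T3) => //.
  by apply: homA_tens => //; apply: homA_id.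
have k0 x : k (i x) = 0.
  have /hom_compl_l/lfunP/(_ x) : homA (k \o i)%VF by apply: homA_comp hk hi.
  by rewrite comp_lfunE zero_lfunE.
have f0 x v : f (i x \oxv v) = 0.
  have /hom_compl_tens_l/lfunP/(_ (x \oxv v)) :
      @homA K W (tensA V0 A) A (f \o (i \oxf \1))%VF.
    apply: (@homA_comp _ _ (tensA V0 A) T3) => //.
    by apply: (@homA_tens _ _ V0 (tensA A A)) => //; apply: homA_id.
  by rewrite comp_lfunE tens_mapE id_lfunE zero_lfunE.
exists (k \o la)%VF; first exact: homA_comp hk hla.
move=> t v; rewrite comp_lfunE.
have -> : f (t \oxv v) = k (mu t \oxv v).
  rewrite comp_lfunE tens_mapE id_lfunE {1}(dec t) -[la _]scale1r pureDl.
  by rewrite linearP /= f0 addr0 !scale1r.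
by rewrite {1}(dec (mu t \oxv v)) linearD /= k0 addr0.
Qed.

Lemma mu_assoc x y z : mu (x \oxv mu (y \oxv z)) = mu (mu (x \oxv y) \oxv z).
Proof.
pose f := (mu \o (\1 \oxf mu) \o assoc_r _ _ _)%VF.
have hf : @homA K W T3 A f.
  apply: (@homA_comp _ _ T3 (tensA A (tensA A A))); last exact: homA_assoc_r.
  apply: (@homA_comp _ _ _ (tensA A A)) => //.
  by apply: (@homA_tens _ _ _ _ (tensA A A)) => //; apply: homA_id.
have [h hh fh] := hom3_factor hf; have [c hc] := schur irrA hh.
have muA x' y' z' :
    mu (x' \oxv mu (y' \oxv z')) = c *: mu (mu (x' \oxv y') \oxv z').
  by rewrite -hc -fh !comp_lfunE assoc_rE tens_mapE id_lfunE.
have [v v0] := irreducible_neq0 irrA.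
by rewrite muA (assoc_scalar_eq1 muK v0 muA) scale1r.
Qed.

Lemma la_coassoc :
  (assoc_r _ _ _ \o (la \oxf \1) \o la = (\1 \oxf la) \o la)%VF.
Proof.
pose f := (assoc_l _ _ _ \o (\1 \oxf la) \o la)%VF.
have hf : @homA K W A T3 f.
  apply: (@homA_comp _ _ _ (tensA A A)) => //.
  apply: (@homA_comp _ _ _ (tensA A (tensA A A))); first exact: homA_assoc_l.
  by apply: (@homA_tens _ _ _ _ _ (tensA A A)) => //; apply: homA_id.
pose k := ((mu \oxf \1) \o f)%VF.
have hk : @homA K W A (tensA A A) k.
  apply: (@homA_comp _ _ _ T3) => //.
  by apply: (@homA_tens _ _ (tensA A A)) => //; apply: homA_id.
have f0 v : (p \oxf \1)%VF (f v) = 0.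
  have /hom_compl_tens_r/lfunP/(_ v) :
      @homA K W A (tensA V0 A) ((p \oxf \1) \o f)%VF.
    apply: (@homA_comp _ _ _ T3) => //.
    by apply: (@homA_tens _ _ (tensA A A)) => //; apply: homA_id.
  by rewrite comp_lfunE zero_lfunE.
have k0 v : p (k v) = 0.
  have /hom_compl_r/lfunP/(_ v) : homA (p \o k)%VF by apply: homA_comp hp hk.
  by rewrite comp_lfunE zero_lfunE.
have dec3 (t : carrier T3) :
    t = (la \oxf \1)%VF ((mu \oxf \1)%VF t) + (i \oxf \1)%VF ((p \oxf \1)%VF t).
  rewrite -!comp_lfunE -add_lfunE -[LHS]id_lfunE; congr (fun_of_lfun _ t).
  apply: tens_ext => s v; rewrite add_lfunE !comp_lfunE !tens_mapE !id_lfunE.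
  by rewrite -[X in X + _]scale1r -pureDl scale1r -dec.
(* Associativity of [mu] moves the product onto the inner [la], where it cancels; this fixes the
   scalar with no second pentagon. *)
have muk v : mu (k v) = v.
  have -> : mu (k v) = (mu \o (\1 \oxf mu) \o assoc_r _ _ _)%VF (f v).
    rewrite /k comp_lfunE -comp_lfunE; congr (fun_of_lfun _ (f v)).
    apply: tens_ext_l => x y z; rewrite !comp_lfunE assoc_rE !tens_mapE !id_lfunE.
    by rewrite mu_assoc.
  rewrite !comp_lfunE assoc_lK -(comp_lfunE (\1 \oxf mu)%VF).
  rewrite (_ : (_ \o _)%VF = \1%VF) ?id_lfunE ?muK //.
  by apply: tens_ext => x y; rewrite comp_lfunE !tens_mapE !id_lfunE muK.
(* Only the component of [f] along the copy of [A] in [T3] survives, and [muk] identifies it as the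
   identity. *)
have fE v : f v = (la \oxf \1)%VF (la v).
  rewrite (dec3 (f v)) f0 linear0 addr0 -[(mu \oxf \1)%VF (f v)]comp_lfunE.
  by rewrite (dec (k v)) k0 linear0 addr0 muk.
apply/lfunP => v; have := congr1 (assoc_r _ _ _) (fE v).
by rewrite !comp_lfunE assoc_lK.
Qed.

End Decomposition.

Lemma regular_K_projector_palgebra (V : vectType K)
    (P : 'Hom((W \ox V)%type, (V \ox W)%type)) :
  regular_K_projector P -> exists M : palgebra V, weak_envelope_rep M (rho_of P).
Proof.
pose A := ObjA P; move=> [_ irrA [V0 [isoV V0z]]].
have [mu [p [la [i [hmu hp hla hi [muK pK dec]]]]]] := iso_sum_decomposition isoV.
have muA : (mu \o (mu \oxf \1) = mu \o (\1 \oxf mu) \o assoc_r _ _ _)%VF.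
  apply: tens_ext_l => x y z.
  rewrite !comp_lfunE assoc_rE !tens_mapE !id_lfunE.
  by rewrite (mu_assoc hmu hla hi muK pK dec irrA V0z).
have laA := la_coassoc hmu hla hp hi muK pK dec irrA V0z.
have muK1 : (mu \o la = \1)%VF by apply/lfunP => v; rewrite comp_lfunE id_lfunE.
by exists (PAlgebra muA laA muK1); apply/weak_envelope_repP.
Qed.

End RegularProjector.

(** * The flip as a counterexample *)

(* The product u v = eps(u) v and the coproduct v |-> e (x) v, where          *)
(* eps(e) = 1, form a P-algebra structure, and the flip is compatible with    *)
(* it; on the flip of V and a line everything acts by scalars.                *)
Section Flip.
Variable K : numClosedFieldType.
Let V : vectType K := (K^o * K^o)%type.
Let W : vectType K := K^o.
Let e : V := (1, 0).

Definition left_mul : 'Hom((V \ox V)%type, V) :=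
  tens_lift (fun u v : V => u.1 *: v).

Definition left_comul : 'Hom(V, (V \ox V)%type) := linfun (pure e).

Lemma left_mulE (u v : V) : left_mul (u \oxv v) = u.1 *: v.
Proof.
rewrite tens_liftE //; split=> x a y z /=.
  by rewrite scalerDr !scalerA mulrC.
by rewrite scalerDl scalerA.
Qed.

Lemma left_comulE v : left_comul v = e \oxv v.
Proof. by rewrite linfunE //; apply: pureDr. Qed.

Lemma left_mulA : (left_mul \o (left_mul \oxf \1)
  = left_mul \o (\1 \oxf left_mul) \o assoc_r V V V)%VF.
Proof.
apply: tens_ext_l => x y z; rewrite !comp_lfunE assoc_rE !tens_mapE !id_lfunE.
by rewrite !left_mulE scalerA.
Qed.

Lemma left_comulA : (assoc_r V V V \o (left_comul \oxf \1) \o left_comul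
  = (\1 \oxf left_comul) \o left_comul)%VF.
Proof.
apply/lfunP => v; rewrite !comp_lfunE left_comulE !tens_mapE !id_lfunE.
by rewrite !left_comulE assoc_rE.
Qed.

Lemma left_mulK : (left_mul \o left_comul = \1)%VF.
Proof.
apply/lfunP => v; rewrite comp_lfunE left_comulE left_mulE id_lfunE.
exact: scale1r.
Qed.

Definition left_palgebra : palgebra V := PAlgebra left_mulA left_comulA left_mulK.

Definition flip : 'Hom((W \ox V)%type, (V \ox W)%type) :=
  tens_lift (fun w v => v \oxv w).

Lemma act_flip w xi v : act (ObjA flip) w xi v = (xi w : K) *: v.
Proof.
rewrite actE /= tens_liftE ?contr_rE //; split=> x a y z.
  exact: pureDl.
exact: pureDr.
Qed.

Lemma act_flip_tens w xi :
  act (tensA (ObjA flip) (ObjA flip)) w xi = (xi w : K) *: \1%VF.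
Proof.
apply: tens_ext => u v; rewrite act_tensA scale_lfunE id_lfunE.
rewrite {2}(vbasis_coord_sum w) linear_sum scaler_suml; apply: eq_bigr => k _.
rewrite !act_flip linearZ (linear_fscale _ _ (pureDl _)).
by rewrite (linear_fscale _ _ (pureDr _)) scalerA.
Qed.

Lemma flip_rep : weak_envelope_rep left_palgebra (rho_of flip).
Proof.
apply/weak_envelope_repP; split=> w xi v.
  by rewrite act_flip act_flip_tens scale_lfunE id_lfunE linearZ.
by rewrite act_flip act_flip_tens scale_lfunE id_lfunE linearZ.
Qed.

Lemma proj_of_flip : proj_of (vbasis {:V}) (rho_of flip) = flip.
Proof.
apply: tens_ext => w u; rewrite proj_ofE.
by rewrite -(rho_of_expansion _ (vbasisP _)).
Qed.

(** The element [1] (x) [\1] acts as the identity, so its trace is the dimension: 4 on the tensor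
    square and 2 on [V], which leaves 2 for [V0]. *)
Lemma flip_compl_neq0 (V0 : objA W) :
    isoA (tensA (ObjA flip) (ObjA flip)) (sumA (ObjA flip) V0) ->
  ~ groth_eq (Gcls V0) Gzero.
Proof.
pose a (A : objA W) : 'End(carrier A) := act A (1 : K^o) (\1%VF : dual W).
have ha : aug a by apply: aug_act.
move=> /(lftrace_iso_sum ha) + /(groth_lftrace ha) a0; rewrite a0.
have -> : a (tensA (ObjA flip) (ObjA flip)) = \1%VF.
  by rewrite /a act_flip_tens id_lfunE scale1r.
have -> : a (ObjA flip) = \1%VF.
  by apply/lfunP => v; rewrite /a act_flip !id_lfunE scale1r.
rewrite addr0 !lftrace1 !dimvf => /eqP.
by rewrite eqr_nat.
Qed.

Lemma e_neq0 : e != 0.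
Proof. by apply/eqP => -[] /eqP; rewrite oner_eq0. Qed.

Lemma fullv_neq0 : {:V}%VS != 0%VS.
Proof.
by apply: contraNneq e_neq0 => V0; rewrite -memv0 -V0 memvf.
Qed.

Lemma flip_reducible : ~ irreducibleA (ObjA flip).
Proof.
case=> _ /(_ <[e]>%VS)[w xi||].
- by rewrite limg_line act_flip -memvE memvZ ?memv_line.
- by move/eqP; rewrite -subv0 -memvE memv0 (negPf e_neq0).
move=> eV; have : ((0, 1) : V) \in <[e]>%VS by rewrite eV memvf.
case/vlineP=> c [] _ /eqP; rewrite scaler0 oner_eq0.
by [].
Qed.

End Flip.

Theorem theorem1 (R : realType) :
  (* (i) *)
  (forall (V W : vectType R[i]) (P : 'Hom((W \ox V)%type, (V \ox W)%type)),
     regular_K_projector P ->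
     exists A : palgebra V, weak_envelope_rep A (rho_of P))
  /\
  (* (ii) *)
  (forall (V W : vectType R[i]) (P : 'Hom((W \ox V)%type, (V \ox W)%type))
          (A : palgebra V) (rho : 'Hom((V \ox dual V)%type, 'End(W))),
     regular_K_projector P ->
     weak_envelope_rep A rho ->
     rho = rho_of P ->
     forall (n : nat) (e : n.-tuple V), basis_of {:V} e ->
     forall (w : W) (u : V),
       P (w \oxv u) = \sum_(j < n) e`_j \oxv (rho (u \oxv dual_coord e j) w))
  /\
  (* (iii) *)
  (forall (V W : vectType R[i]) (A : palgebra V)
          (rho : 'Hom((V \ox dual V)%type, 'End(W))),
     weak_envelope_rep A rho ->
     forall (n : nat) (e : n.-tuple V), basis_of {:V} e ->
     let VP := ObjA (proj_of e rho) in
     exists V0 : objA W, isoA (tensA VP VP) (sumA VP V0))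
  /\
  (exists (V W : vectType R[i]) (A : palgebra V)
          (rho : 'Hom((V \ox dual V)%type, 'End(W)))
          (n : nat) (e : n.-tuple V),
     [/\ weak_envelope_rep A rho, basis_of {:V} e &
         let VP := ObjA (proj_of e rho) in
         exists V0 : objA W,
           isoA (tensA VP VP) (sumA VP V0) /\ ~ groth_eq (Gcls V0) Gzero])
  /\
  (exists (V W : vectType R[i]) (A : palgebra V)
          (rho : 'Hom((V \ox dual V)%type, 'End(W)))
          (n : nat) (e : n.-tuple V),
     [/\ weak_envelope_rep A rho, basis_of {:V} e, ({:V} != 0)%VS &
         ~ irreducibleA (ObjA (proj_of e rho))]).
Proof.
split; first by move=> V W P; apply: regular_K_projector_palgebra.
split; first by move=> V W P A rho _ _ -> n e be w u; apply: rho_of_expansion.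
split.
  (* Every [rho] comes from its [proj_of], so the criterion [weak_envelope_repP] applies to it. *)
  move=> V W A rho hrho n e be VP; rewrite -(rho_of_proj_of rho be) in hrho.
  have [hmu hla] := (weak_envelope_repP _ _).1 hrho.
  apply: (@split_summand _ _ VP (tensA VP VP) _ _ hmu hla) => v.
  by rewrite -comp_lfunE pmulK id_lfunE.
have [hmu hla] := (weak_envelope_repP _ _).1 (flip_rep R[i]).
split; exists (R[i]^o * R[i]^o)%type, R[i]^o, (left_palgebra _), (rho_of (flip _)).
  exists _, (vbasis fullv); split; [exact: flip_rep | exact: vbasisP |].
  rewrite proj_of_flip.
  have [|V0 isoV] := split_summand hmu hla.
    by move=> v; rewrite -comp_lfunE pmulK id_lfunE.
  by exists V0; split=> //; apply: flip_compl_neq0.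
exists _, (vbasis fullv); split.
- exact: flip_rep.
- exact: vbasisP.
- exact: fullv_neq0.
- by rewrite proj_of_flip; apply: flip_reducible.
Qed.
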